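(* There exists a universal constant $\delta\in(0,1)$ (independent of $m$, $A$, $F$ and $\omega$) such that the following holds. Let $m\ge 1$, $\omega>0$, $F\in\mathbb{C}^m$, and let $A\in\mathbb{C}^{m\times m}$ be a matrix with eigenvalues $\{\lambda_j\}_{j=1}^m$ satisfying: 1. (Stability) $\Re\lambda_j\le 0$ for all $j$; 2. (Existence and uniqueness) $\lambda_j\ne i\omega$ and $\lambda_j\neq -i\omega$ for all $j$; 3. $A$ can be diagonalized as $A=R\Lambda R^{-1}$ with $\Lambda=\mathrm{diag}(\lambda_1,\dots,\lambda_m)$ and $R\in\mathbb{C}^{m\times m}$ invertible. Let $\hat w_h^\star\in\mathbb{C}^m$ be the solution of the discrete Helmholtz equation $i\omega\hat w=A\hat w-F$, and define $$\varepsilon=\min_j\min\left\{d(\lambda_j/\omega,i),\,d(\lambda_j/\omega,-i)\right\},$$ where $d$ is the parabolic distance function. Then $\varepsilon>0$, and there is a number $r\in(0,1)$ (a convergence rate, depending only on $A$ and $\omega$) with $$r\le\max\{1-\varepsilon,\,1-\delta\}$$ such that, for every initial vector $\hat w_h^{(0)}\in\mathbb{C}^m$, the WaveHoltz iterates $\hat w_h^{(n)}$ converge, $\hat w_h^{(n)}\to\hat w_h^\star$ as $n\to\infty$, and, for any $p$-norm $\|\cdot\|$ ($1\le p\le\infty$) on $\mathbb{C}^m$ and every $n\ge 0$, $$\|R^{-1}(\hat w_h^{(n+1)}-\hat w_h^\star)\|\le r\,\|R^{-1}(\hat w_h^{(n)}-\hat w_h^\star)\|$$ and $$\|\hat w_h^{(n)}-\hat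 w_h^\star\|\le\kappa(R)\,r^n\,\|\hat w_h^{(0)}-\hat w_h^\star\|,$$ where $\kappa(R)=\|R\|\cdot\|R^{-1}\|$ is the condition number of $R$ in the induced matrix norm.
   Context: Parabolic distance: for $z_1,z_2\in\mathbb{C}$, $$d(z_1,z_2)=|\Re(z_1-z_2)|+\alpha\,|\Im(z_1-z_2)|^2,\qquad \alpha=\frac{2\pi^2-3}{12\pi}.$$ WaveHoltz iteration: given $A\in\mathbb{C}^{m\times m}$, $F\in\mathbb{C}^m$, $\omega>0$, put $T=2\pi/\omega$. For $\hat w\in\mathbb{C}^m$ define $$\Pi_h\hat w=\frac{2}{T}\int_0^T\left(\cos(\omega t)-\frac14\right)w(t)\,dt,$$ where $w:[0,T]\to\mathbb{C}^m$ is the (exact) solution of the initial value problem $$\frac{dw}{dt}=Aw-Fe^{i\omega t},\qquad w(0)=\hat w.$$ The WaveHoltz iterates with initial vector $\hat w_h^{(0)}$ are $\hat w_h^{(n+1)}=\Pi_h\hat w_h^{(n)}$, $n\ge0$. *)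

(* Defs.v *)
From HB Require Import structures.
From mathcomp Require Import all_boot all_order all_algebra.
From mathcomp Require Import all_classical all_reals all_analysis.
From mathcomp Require Import complex.

Set Implicit Arguments.
Unset Strict Implicit.
Unset Printing Implicit Defensive.

Import Order.TTheory GRing.Theory Num.Theory.
Import numFieldNormedType.Exports.

Local Open Scope classical_set_scope.
Local Open Scope complex_scope.
Local Open Scope ring_scope.

Section Norms.
Variable K : realType.

(* Only exponents [1 <= p] are meant; the [-oo] branch is a dummy value. *)
Definition pnorm (m : nat) (p : \bar K) (v : 'cV[K[i]]_m) : K :=
  match p with
  | q%:E => (\sum_(j < m) (ComplexField.Normc.normc (v j ord0) `^ q)) `^ q^-1
  | +oo%E => \big[Num.max/0]_(j < m) ComplexField.Normc.normc (v j ord0)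
  | -oo%E => 0
  end.

Definition op_pnorm (m : nat) (p : \bar K) (M : 'M[K[i]]_m) : K :=
  sup [set pnorm p (M *m v) / pnorm p v | v in [set v : 'cV[K[i]]_m | v != 0]].

Definition cond_number (m : nat) (p : \bar K) (M : 'M[K[i]]_m) : K :=
  op_pnorm p M * op_pnorm p (invmx M).

(* The cast to [numFieldType] is what selects the norm topology on [K[i]], from
   which the library derives the topology on matrices. *)
Definition cvg_vec (m : nat) (u : nat -> 'cV[K[i]]_m) (l : 'cV[K[i]]_m) : Prop :=
  (u : nat -> 'cV[(K[i] : numFieldType)]_m) n @[n --> \oo]
    --> (l : 'cV[(K[i] : numFieldType)]_m).

End Norms.

Section ParabolicDistance.
Variable K : realType.

Definition parabolic_alpha : K := (2 * pi ^+ 2 - 3) / (12 * pi).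

Definition pdist (z1 z2 : K[i]) : K :=
  `|complex.Re (z1 - z2)| + parabolic_alpha * `|complex.Im (z1 - z2)| ^+ 2.

Definition pdist_pm (omega : K) (l : K[i]) : K :=
  Num.min (pdist (l / omega%:C) 'i%C) (pdist (l / omega%:C) (- 'i%C)).

(* The default value of the iterated minimum is one of its terms. *)
Definition resonance_dist (m : nat) (omega : K) (lambda : 'rV[K[i]]_m.+1) : K :=
  \big[Num.min/pdist_pm omega (lambda ord0 ord0)]_(j < m.+1)
    pdist_pm omega (lambda ord0 j).

End ParabolicDistance.

Section WaveHoltz.
Variables (K : realType) (m : nat).
Implicit Types (A : 'M[K[i]]_m) (F w : 'cV[K[i]]_m) (omega : K).

Definition expi (theta : K) : K[i] := cos theta +i* sin theta.

Definition period omega : K := 2 * pi / omega.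

Definition rhs A F omega (t : K) (w : 'cV[K[i]]_m) : 'cV[K[i]]_m :=
  A *m w - expi (omega * t) *: F.

(* Functions [K -> K[i]] of a real variable are continuous, differentiable and
   integrated through their real and imaginary parts. *)
Definition is_ivp_solution A F omega w0 (w : K -> 'cV[K[i]]_m) : Prop :=
  [/\ w 0 = w0,
      forall j : 'I_m,
        {within `[0, period omega], continuous (fun t => complex.Re (w t j ord0))}
     /\ {within `[0, period omega], continuous (fun t => complex.Im (w t j ord0))}
    & forall (t : K) (j : 'I_m), 0 < t < period omega ->
        is_derive t 1 (fun s : K => complex.Re (w s j ord0))
          (complex.Re (rhs A F omega t (w t) j ord0))
     /\ is_derive t 1 (fun s : K => complex.Im (w s j ord0))
          (complex.Im (rhs A F omega t (w t) j ord0))].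

(* The solution of the initial value problem (unique on [0, T]); the default
   value [fun=> 0] is never used as a solution always exists. *)
Definition ivp_solution A F omega w0 : K -> 'cV[K[i]]_m :=
  xget (fun=> 0) [set w | is_ivp_solution A F omega w0 w].

Definition cintegral (a b : K) (f : K -> K[i]) : K[i] :=
  (\int[lebesgue_measure]_(t in `[a, b]) complex.Re (f t)) +i*
  (\int[lebesgue_measure]_(t in `[a, b]) complex.Im (f t)).

Definition waveholtz A F omega w0 : 'cV[K[i]]_m :=
  \col_j ((2 / period omega)%:C *
    cintegral 0 (period omega)
      (fun t => (cos (omega * t) - 4^-1)%:C * ivp_solution A F omega w0 t j ord0)).

Definition waveholtz_iterate A F omega w0 (n : nat) : 'cV[K[i]]_m :=
  iter n (waveholtz A F omega) w0.

Definition helmholtz A F omega (w : 'cV[K[i]]_m) : Prop :=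
  ('i%C * omega%:C) *: w = A *m w - F.

End WaveHoltz.

(* Main.v *)
Require Import Defs.
From HB Require Import structures.
From mathcomp Require Import all_boot all_order all_algebra.
From mathcomp Require Import all_classical all_reals all_analysis.
From mathcomp Require Import complex ring lra.

(** In the eigenbasis of [A] the exact solution is [w(t) = exp(i omega t) ws +
R exp(Lambda t) R^-1 (w0 - ws)], [ws] being the Helmholtz solution.
The time filter maps [exp(i omega t)] to [1], so the error is multiplied by [R diag(beta(lambda_j / omega)) R^-1], where
[beta(z) = (exp(2 pi z) - 1) (3 z^2 - 1) / (4 pi z (z^2 + 1))].

It remains to bound [|beta|] in the closed left half plane, and by conjugation
[Im z >= 0] may be assumed. With [u = z - i] one has
[3 z^2 - 1 = 2 z (z + i) + u^2], so [beta] is the product of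
[(exp(2 pi u) - 1) / (2 pi u)] and [1 + u^2 / (2 z (z + i))].
- For [|z| <= 2/5], [|exp(2 pi z) - 1| <= 2 pi |z|] suffices.
- For [|z|, |u| >= 2/5], [|exp(2 pi z) - 1| <= 2] and [pi >= 3] suffice.
- For [|u| <= 2/5], [|exp(2 pi u) - 1|^2 = (1 - q)^2 + 4 q sin^2 (pi Im u)] with
  [q = exp(2 pi Re u)], and second order bounds give [|beta| <= 1 - d(z, i)]; there
  is room to spare because [|beta| = 1 - pi d(z, i) + ...] near [i].
Hence [delta = 1/100] and [r = max (1 - epsilon) (1 - delta)] work. *)

Set Implicit Arguments.
Unset Strict Implicit.
Unset Printing Implicit Defensive.

Import Order.TTheory GRing.Theory Num.Theory.
Import numFieldNormedType.Exports.

Local Open Scope classical_set_scope.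
Local Open Scope complex_scope.
Local Open Scope ring_scope.

(** * Elementary real bounds *)

Section RealBounds.
Context {K : realType}.
Implicit Types x y : K.

(** The bounds on [sin] and [exp] below apply this to the difference of their two sides, which
    vanishes at 0. *)
Lemma derive_ge0_nondecreasing (f df : K -> K) a b : a <= b ->
  (forall x, is_derive x 1 f (df x)) -> (forall x, a <= x -> 0 <= df x) ->
  f a <= f b.
Proof.
move=> ab fdf df0; have [|c] := @MVT_segment _ f df a b ab.
  apply: continuous_subspaceT => x.
  by apply/differentiable_continuous/derivable1_diffP; case: (fdf x).
rewrite in_itv/= => /andP[ac _] fE.
by rewrite -subr_ge0 fE mulr_ge0 ?subr_ge0// df0.
Qed.

Lemma sin_le_id x : 0 <= x -> sin x <= x.
Proof.
move=> x0; rewrite -subr_ge0.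
have := @derive_ge0_nondecreasing (fun t => t - sin t) (fun t => 1 - cos t) _ _ x0.
rewrite sin0 subr0; by apply=> t _; rewrite subr_ge0 cos_le1.
Qed.

Lemma sin2_le_sqr x : sin x ^+ 2 <= x ^+ 2.
Proof.
wlog x0 : x / 0 <= x => [hw|].
  have [/hw//|/ltW x0] := leP 0 x.
  by rewrite -(opprK x) sinN sqrrN [leRHS]sqrrN hw// oppr_ge0.
have [xp|px] := leP x pi; last first.
  apply: (@le_trans _ _ 1).
    by rewrite sin2cos2 gerBl sqr_ge0.
  by have := @pi_ge2 K => p2; nra.
by rewrite lerXn2r ?nnegrE ?sin_ge0_pi ?x0 ?sin_le_id.
Qed.

Lemma cos_double (x : K) : cos (2 * x) = 1 - 2 * sin x ^+ 2.
Proof. by rewrite mulr_natl cos_mulr2n cos2sin2 -mulr_natl; ring. Qed.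

Lemma sin2_double (x : K) : sin (2 * x) ^+ 2 = 4 * (sin x ^+ 2 * (1 - sin x ^+ 2)).
Proof. by rewrite mulr_natl sin_mulr2n -mulr_natl -cos2sin2; ring. Qed.

(* Doubling the angle in [sin2_le_sqr], as [s (1 - s)] increases on [[0, 1/2]]. *)
Lemma sin2_le_quartic x : x ^+ 2 <= 2 -> sin x ^+ 2 <= x ^+ 2 * (1 - x ^+ 2 / 4).
Proof.
move=> x2; have -> : x = 2 * (x / 2) by field.
rewrite sin2_double; set w := x / 2.
have := sin2_le_sqr w; have := sqr_ge0 (sin w).
have w2 : w ^+ 2 <= 1 / 2 by rewrite /w; lra.
have -> : (2 * w) ^+ 2 * (1 - (2 * w) ^+ 2 / 4) = 4 * (w ^+ 2 * (1 - w ^+ 2)) by field.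
move: (sin w ^+ 2) (w ^+ 2) w2 => s t; nra.
Qed.

(** The derivative of the difference is [cos t - (1 - t^2 / 2)], nonnegative by the half-angle
    formula and [sin2_le_sqr]. *)
Lemma sin_ge_cubic x : 0 <= x -> x - x ^+ 3 / 6 <= sin x.
Proof.
move=> x0; rewrite -subr_ge0.
have := @derive_ge0_nondecreasing (fun t => sin t - (t - t ^+ 3 / 6))
  (fun t => cos t - (1 - t ^+ 2 / 2)) _ _ x0.
rewrite sin0 expr0n/= mul0r !subr0; apply=> t *.
  apply: is_derive_eq; rewrite /GRing.scale/=.
  by field.
have -> : t = 2 * (t / 2) by field.
rewrite cos_double; have := sin2_le_sqr (t / 2); nra.
Qed.

(** If [pi < 3], then [3/2] lies beyond [pi/2] and has cosine at most 0. But the quartic bound gives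
    [sin^2 (3/4) <= 495/1024 < 1/2], so [cos (3/2) > 0]. *)
Lemma pi_ge3 : 3 <= pi :> K.
Proof.
rewrite leNgt; apply/negP => p3; have p2 := @pi_ge2 K.
suff : cos (3 / 2) <= 0 :> K.
  have -> : 3 / 2 = 2 * (3 / 4) :> K by field.
  rewrite cos_double; have : (3 / 4 : K) ^+ 2 <= 2 by lra.
  move=> /sin2_le_quartic; lra.
rewrite -(@cos_pihalf K) leNgt ltr_cos ?in_itv/= -?leNgt; try apply/andP; lra.
Qed.

(** If [pi > 17/5], then [17/10] lies before [pi/2] and has positive cosine. But
    [sin (17/20) >= 74/100] makes [1 - 2 sin^2 (17/20)] negative. *)
Lemma pi_le17_5 : pi <= 17 / 5 :> K.
Proof.
rewrite leNgt; apply/negP => p3.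
suff : 0 < cos (17 / 10) :> K.
  have -> : 17 / 10 = 2 * (17 / 20) :> K by field.
  rewrite cos_double; have : (0 <= 17 / 20 :> K) by lra.
  move=> /sin_ge_cubic; have : 74 / 100 <= (17 / 20) - (17 / 20 : K) ^+ 3 / 6 by lra.
  nra.
by apply: cos_gt0_pihalf; apply/andP; lra.
Qed.

(** The upper bound amounts to [2 pi^2 - 6 pi <= 3], for which [pi <= 17/5] is sharp enough. It lets
    [1/2] replace alpha near resonance; positivity makes the parabolic distance separate points. *)
Lemma parabolic_alpha_bound : 0 < parabolic_alpha K <= 1 / 2.
Proof.
have p0 := @pi_gt0 K; have p3 := pi_ge3; have p4 := pi_le17_5.
rewrite /parabolic_alpha divr_gt0/= ?mulr_gt0//; last nra.
rewrite ler_pdivrMr ?mulr_gt0//; nra.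
Qed.

(** This is [tanh x <= x] rewritten. Once the denominator is cleared, the difference has derivative
    [1 - exp (-2t) (1 + 2t)], nonnegative by [exp s >= 1 + s]. *)
Lemma oneBexpRN_le x : 0 <= x -> 1 - expR (- (2 * x)) <= 2 * x / (1 + x).
Proof.
move=> x0; rewrite ler_pdivlMr; last by lra.
have := @derive_ge0_nondecreasing (fun t => 2 * t - (1 - expR (- (2 * t))) * (1 + t))
  (fun t => 1 - expR (- (2 * t)) * (1 + 2 * t)) _ _ x0.
rewrite mulr0 oppr0 expR0 subrr mul0r subr0 subr_ge0; apply=> t.
  by apply: is_derive_eq; rewrite /GRing.scale/=; ring.
move=> t0; rewrite expRN subr_ge0 mulrC ler_pdivrMr ?expR_gt0// mul1r.
exact: expR_ge1Dx.
Qed.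

(** Squaring [exp x >= 1 + x] produces the square of the denominator in [oneBexpRN_le], so that both
    bounds can be added in [normc_period_jump_near]. *)
Lemma expRN2_le x : 0 <= x -> expR (- (2 * x)) <= (1 + x) ^- 2.
Proof.
move=> x0; rewrite expRN lef_pV2 ?posrE ?expR_gt0 ?exprn_gt0//; last lra.
by rewrite expRM_natl lerXn2r ?nnegrE ?expR_ge1Dx ?expR_ge0//; lra.
Qed.

End RealBounds.

(** * The symbol of the time filter *)

Section FilterSymbol.
Context {K : realType}.
Implicit Types (x y : K) (z w : K[i]).
Import ComplexField.Normc.

Lemma normc_ge0 z : 0 <= normc z.
Proof. by case: z => a b; exact: sqrtr_ge0. Qed.

Lemma sqr_normc_def z : normc z ^+ 2 = complex.Re z ^+ 2 + complex.Im z ^+ 2.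
Proof. by case: z => a b /=; rewrite sqr_sqrtr// addr_ge0// sqr_ge0. Qed.

Lemma normc_gt0 z : z != 0 -> 0 < normc z.
Proof.
by move=> z0; rewrite lt_def normc_ge0 andbT; apply: contra_neq z0 => /eq0_normc.
Qed.

Lemma normc_triangle z w : normc (z + w) <= normc z + normc w.
Proof. exact: (le_normcD (z : Rcomplex K)). Qed.

Lemma normc_opp z : normc (- z) = normc z.
Proof. exact: (normcN (z : Rcomplex K)). Qed.

Lemma normc_real x : 0 <= x -> normc x%:C = x.
Proof. by move=> x0; rewrite /= expr0n addr0 sqrtr_sqr ger0_norm. Qed.

Lemma normc_nat n : normc (n%:R : K[i]) = n%:R.
Proof. by rewrite -(rmorph_nat (real_complex K)) normc_real. Qed.

Lemma normc_conj z : normc z^*%C = normc z.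
Proof. by case: z => a b /=; rewrite sqrrN. Qed.

Lemma normc_i : normc 'i%C = 1 :> K.
Proof. by rewrite /= expr0n add0r expr1n sqrtr1. Qed.

Lemma normcX z n : normc (z ^+ n) = normc z ^+ n.
Proof. by elim: n => [|n IH]; rewrite ?normc1// !exprS normcM IH. Qed.

Definition cexp z : K[i] := (expR (complex.Re z))%:C * expi (complex.Im z).

Lemma sqr_normc_cexpB1 z : normc (cexp z - 1) ^+ 2 =
  (1 - expR (complex.Re z)) ^+ 2
  + 4 * expR (complex.Re z) * sin (complex.Im z / 2) ^+ 2.
Proof.
case: z => a b; rewrite sqr_normc_def /cexp /expi /= !mul0r subr0 addr0 subr0.
have cE : cos b = 1 - 2 * sin (b / 2) ^+ 2 by rewrite -cos_double; congr cos; field.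
have := cos2Dsin2 b; rewrite cE exprMn.
by move: (sin (b / 2) ^+ 2) (sin b ^+ 2) (expR a) => s t q h; nra.
Qed.

(** The increment of [exp (z s)] as [s] runs over [[0, 2 pi]]. *)
Definition period_jump z : K[i] := cexp ((2 * pi)%:C * z) - 1.

Lemma sqr_normc_period_jump x y : normc (period_jump (x +i* y)) ^+ 2 =
  (1 - expR (2 * pi * x)) ^+ 2 + 4 * expR (2 * pi * x) * sin (pi * y) ^+ 2.
Proof.
rewrite sqr_normc_cexpB1 /= !mul0r subr0 addr0.
by have -> : 2 * pi * y / 2 = pi * y by field.
Qed.

Lemma normc_period_jump_conj z : normc (period_jump z^*%C) = normc (period_jump z).
Proof.
apply/eqP; rewrite -(eqrXn2 (n := 2)) ?normc_ge0//; apply/eqP.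
by case: z => x y /=; rewrite !sqr_normc_period_jump mulrN sinN sqrrN.
Qed.

Lemma normc_period_jump_le2 z : complex.Re z <= 0 -> normc (period_jump z) <= 2.
Proof.
case: z => x y /= x0; rewrite -(ler_pXn2r (n := 2)) ?nnegrE ?normc_ge0//.
rewrite sqr_normc_period_jump.
have q0 : 0 <= expR (2 * pi * x) by exact: expR_ge0.
have q1 : expR (2 * pi * x) <= 1.
  by rewrite -expR0 ler_expR mulr_ge0_le0// mulr_ge0// pi_ge0.
have := cos2Dsin2 (pi * y); have := sqr_ge0 (cos (pi * y)).
have := sqr_ge0 (sin (pi * y)).
move: (expR _) (sin _ ^+ 2) (cos _ ^+ 2) q0 q1 => q s c *.
have : q * s <= q * 1 by apply: ler_wpM2l; lra.
nra.
Qed.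

Lemma normc_period_jump_le z : complex.Re z <= 0 ->
  normc (period_jump z) <= 2 * pi * normc z.
Proof.
have p0 := @pi_ge0 K.
case: z => x y /= x0; rewrite -(ler_pXn2r (n := 2)) ?nnegrE ?normc_ge0//; last first.
  by rewrite mulr_ge0 ?sqrtr_ge0// mulr_ge0.
rewrite sqr_normc_period_jump exprMn sqr_sqrtr ?addr_ge0 ?sqr_ge0//.
have q0 : 0 <= expR (2 * pi * x) by exact: expR_ge0.
have q1 : expR (2 * pi * x) <= 1.
  by rewrite -expR0 ler_expR mulr_ge0_le0// mulr_ge0.
have q2 : 1 - expR (2 * pi * x) <= - (2 * pi * x).
  by have := expR_ge1Dx (2 * pi * x); lra.
have := sin2_le_sqr (pi * y); have := sqr_ge0 (sin (pi * y)).
move: (expR _) (sin _ ^+ 2) q0 q1 q2 => q s q0 q1 q2 s0 s1.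
have h1 : (1 - q) ^+ 2 <= (2 * pi * x) ^+ 2.
  by rewrite -[leRHS]sqrrN lerXn2r ?nnegrE//; lra.
have h2 : q * s <= (pi * y) ^+ 2 by rewrite (le_trans _ s1)// ler_piMl.
rewrite -mulrA mulrDr -exprMn; nra.
Qed.

(** By periodicity the first-order size is [2 pi |z - i|]; the fraction is a second-order
    correction. Its numerator comes from the quartic sine bound with [pi^2 >= 9], its denominator
    from the exponential bounds with [pi >= 3]. *)
Lemma normc_period_jump_near x y : x <= 0 -> normc (x +i* (y - 1)) <= 2 / 5 ->
  normc (period_jump (x +i* y)) <=
  2 * pi * normc (x +i* (y - 1))
    * ((1 - 9 / 8 * (y - 1) ^+ 2 + 9 / 8 * x ^+ 2) / (1 - 3 * x)).
Proof.
have p3 := @pi_ge3 K; have p4 := @pi_le17_5 K.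
move=> x0; set b := normc _ => b25.
have b2 : b ^+ 2 = x ^+ 2 + (y - 1) ^+ 2 by rewrite sqr_normc_def.
have b0 : 0 <= b by exact: normc_ge0.
set Y := y - 1 in b2 *.
have x2 := sqr_ge0 x; have Y2 := sqr_ge0 Y.
have bb : b ^+ 2 <= 4 / 25 by nra.
have -> : x +i* y = x +i* (Y + 1) by rewrite /Y subrK.
have S0 : 0 <= 1 - 9 / 8 * Y ^+ 2 + 9 / 8 * x ^+ 2 by nra.
rewrite -(ler_pXn2r (n := 2)) ?nnegrE ?normc_ge0//; last first.
  by apply: mulr_ge0; [rewrite !mulr_ge0//; lra | rewrite divr_ge0//; lra].
rewrite sqr_normc_period_jump (mulrDr pi) mulr1 sinDpi sqrrN.
have q1 : 1 - expR (2 * pi * x) <= 2 * pi * (- x) / (1 - 3 * x).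
  have -> : 2 * pi * x = - (2 * (pi * (- x))) by ring.
  have px : 0 <= pi * (- x) by rewrite mulr_ge0; lra.
  apply: (le_trans (oneBexpRN_le px)).
  rewrite !mulrA ler_wpM2l ?lef_pV2 ?posrE//; nra.
have q2 : expR (2 * pi * x) <= (1 - 3 * x) ^- 2.
  have -> : 2 * pi * x = - (2 * (pi * (- x))) by ring.
  have px : 0 <= pi * (- x) by rewrite mulr_ge0; lra.
  apply: (le_trans (expRN2_le px)).
  rewrite lef_pV2 ?posrE ?exprn_gt0 ?lerXn2r ?nnegrE//; nra.
have s1 : sin (pi * Y) ^+ 2 <= pi ^+ 2 * (Y ^+ 2 - 9 / 4 * Y ^+ 2 ^+ 2).
  have pl : 9 <= (pi : K) ^+ 2 by nra.
  have pu : (pi : K) ^+ 2 <= 289 / 25 by nra.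
  have Yu : Y ^+ 2 <= 4 / 25 by lra.
  (* The product [289/25 * 4/25] is below 2, the range of [sin2_le_quartic]. *)
  have : (pi * Y) ^+ 2 <= 2.
    rewrite exprMn; apply: (le_trans (ler_pM _ Y2 pu Yu)); first exact: sqr_ge0.
    lra.
  move=> /sin2_le_quartic /le_trans; apply; rewrite exprMn.
  have -> : Y ^+ 2 - 9 / 4 * Y ^+ 2 ^+ 2 = Y ^+ 2 * (1 - 9 / 4 * Y ^+ 2) by ring.
  have pY := ler_wpM2r Y2 pl.
  rewrite -[leLHS]mulrA; apply: ler_wpM2l; first exact: sqr_ge0.
  by apply: ler_wpM2l => //; lra.
have q0 : 0 <= 1 - expR (2 * pi * x).
  by rewrite subr_ge0 -[leRHS]expR0 ler_expR mulr_ge0_le0// mulr_ge0//; lra.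
have h1 : (1 - expR (2 * pi * x)) ^+ 2 <= (2 * pi) ^+ 2 * x ^+ 2 * (1 - 3 * x) ^- 2.
  have -> : (2 * pi) ^+ 2 * x ^+ 2 * (1 - 3 * x) ^- 2
    = (2 * pi * (- x) / (1 - 3 * x)) ^+ 2 by field; lra.
  by rewrite lerXn2r ?nnegrE//; apply: (le_trans q0).
have h2 : expR (2 * pi * x) * sin (pi * Y) ^+ 2 <=
    (1 - 3 * x) ^- 2 * (pi ^+ 2 * (Y ^+ 2 - 9 / 4 * Y ^+ 2 ^+ 2)).
  by rewrite ler_pM ?expR_ge0 ?sqr_ge0.
apply: (@le_trans _ _ ((2 * pi) ^+ 2 * (1 - 3 * x) ^- 2 *
    (x ^+ 2 + Y ^+ 2 - 9 / 4 * Y ^+ 2 ^+ 2))); first by nra.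
have -> : (2 * pi * b * ((1 - 9 / 8 * Y ^+ 2 + 9 / 8 * x ^+ 2) / (1 - 3 * x))) ^+ 2 =
   (2 * pi) ^+ 2 * (1 - 3 * x) ^- 2 *
     (b ^+ 2 * (1 - 9 / 8 * Y ^+ 2 + 9 / 8 * x ^+ 2) ^+ 2) by field; lra.
rewrite b2.
apply: ler_wpM2l; first by rewrite mulr_ge0 ?invr_ge0 ?sqr_ge0.
(* With [X = x^2] and [t = Y^2], the linear part of the expanded square contributes [(X + t) (1 -
   9/4 (t - X)) = X + t - 9/4 t^2 + 9/4 X^2], which already suffices; the quadratic part is
   nonnegative. *)
have := sqr_ge0 (9 / 8 * Y ^+ 2 - 9 / 8 * x ^+ 2).
move: (x ^+ 2) (Y ^+ 2) x2 Y2 => X t X0 t0 *.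
have : 0 <= (X + t) * (9 / 8 * t - 9 / 8 * X) ^+ 2 by rewrite mulr_ge0// addr_ge0.
by have := sqr_ge0 X; lra.
Qed.

(* Closed form of [1/pi * \int_0^(2 pi) (cos s - 1/4) exp(z s) ds], away from the
   removable singularities [+-i]. *)
Definition filter_symbol z : K[i] :=
  if z == 0 then - 2^-1 else
  period_jump z * (3 * z ^+ 2 - 1) / (4 * pi%:C * z * (z ^+ 2 + 1)).

Lemma sqr_add1_factor z : z ^+ 2 + 1 = (z - 'i%C) * (z + 'i%C).
Proof. by rewrite -subr_sqr sqr_i opprK. Qed.

Lemma normc_filter_symbol z : z != 0 -> normc (filter_symbol z) =
  normc (period_jump z) * normc (3 * z ^+ 2 - 1)
  / (4 * pi * normc z * (normc (z - 'i%C) * normc (z + 'i%C))).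
Proof.
move=> z0; rewrite /filter_symbol (negbTE z0) sqr_add1_factor.
by rewrite !(normcM, normcV) !normc_nat normc_real// pi_ge0.
Qed.

End FilterSymbol.

(** * Bounds on the filter symbol in the closed left half plane *)

Section Contraction.
Context {K : realType}.
Implicit Types (x y : K) (z w : K[i]).
Import ComplexField.Normc.

(** Here [x] and [y] are the parts of [z - i], the letters [a], [b], [c] stand for [|z|], [|z - i|],
    [|z + i|], and [e], [n] for the moduli of [period_jump z] and [3 z^2 - 1]. The right-hand side
    is at most [1 - d(z, i)] since alpha is at most [1/2]. *)
Lemma near_resonance_arith x y a b c e n : x <= 0 -> 0 < b -> b <= 2 / 5 ->
  b ^+ 2 = x ^+ 2 + y ^+ 2 -> 0 <= e -> 0 <= n ->
  e <= 2 * pi * b * ((1 - 9 / 8 * y ^+ 2 + 9 / 8 * x ^+ 2) / (1 - 3 * x)) ->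
  n <= 2 * a * c + b ^+ 2 -> 24 / 25 <= a * c ->
  e * n / (4 * pi * a * (b * c)) <= 1 + x - y ^+ 2 / 2.
Proof.
have p0 := @pi_gt0 K.
move=> x0 b0 b25 b2 e0 n0 ej nb ac.
have bb : b ^+ 2 <= 4 / 25 by nra.
have x2 := sqr_ge0 x; have y2 := sqr_ge0 y.
rewrite [X in _ / X](_ : _ = 4 * pi * b * (a * c)); last by ring.
rewrite ler_pdivrMr; last by apply: mulr_gt0; [rewrite !mulr_gt0|lra].
apply: (le_trans (ler_pM e0 n0 ej nb)).
set S := 1 - _ + _; have S0 : 0 <= S by rewrite /S; nra.
rewrite [leLHS](_ : _ = 2 * pi * b * (S * (2 * (a * c) + b ^+ 2) / (1 - 3 * x)));
  last by field; lra.
rewrite [leRHS](_ : _ = 2 * pi * b * ((1 + x - y ^+ 2 / 2) * (2 * (a * c))));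
  last by field.
apply: ler_wpM2l; first by rewrite !mulr_ge0//; lra.
rewrite ler_pdivrMr; last lra.
(* From [2 a c >= 48/25], one has [2 a c + b^2 <= 2 a c (1 + 25/48 b^2)]. *)
apply: (@le_trans _ _ (S * (1 + b ^+ 2 * (25 / 48)) * (2 * (a * c)))).
  rewrite -mulrA; apply: ler_wpM2l => //.
  have := ler_wpM2l (sqr_ge0 b) ac; lra.
rewrite [leRHS]mulrAC; apply: ler_wpM2r; first lra.
rewrite /S b2; move: b2 bb => -> {S S0 nb ej e0 n0 ac b0 b25}.
move: (y ^+ 2) y2 => t t0 xt.
(* A polynomial inequality in [x] and [t = y^2] remains. The coefficient of [t] is
   [-(9/8 - 25/48) = -29/48] on the left and [-1/2] on the right; this surplus and the term [-2 x]
   on the right outweigh the terms in [x^2], [x t] and [x^4] because [x^2 + t <= 4/25]. *)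
have xl : - (2 / 5) <= x by nra.
have x3 : 0 <= - x * (4 / 25 - x ^+ 2 - t) by rewrite mulr_ge0; lra.
have x4 : x ^+ 2 ^+ 2 <= 4 / 25 * x ^+ 2 by nra.
have x5 : x ^+ 2 <= - x * (2 / 5) by nra.
have x6 := sqr_ge0 t.
nra.
Qed.

Lemma normc_filter_symbol_le z : complex.Re z <= 0 -> 0 <= complex.Im z ->
  z != 'i%C ->
  normc (filter_symbol z) <= 99 / 100 \/
  normc (filter_symbol z) <= 1 - pdist z 'i%C.
Proof.
move=> x0 y0 zi; have p3 := @pi_ge3 K.
have [->|z0] := eqVneq z 0.
  left; rewrite /filter_symbol eqxx normc_opp normcV normc_nat; lra.
rewrite normc_filter_symbol//.
have a0 := normc_gt0 z0; have zi0 : z - 'i%C != 0 by rewrite subr_eq0.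
have b0 := normc_gt0 zi0.
have c1 : 1 <= normc (z + 'i%C).
  rewrite -(ler_pXn2r (n := 2)) ?nnegrE ?normc_ge0// sqr_normc_def.
  case: z x0 y0 {zi z0 a0 zi0 b0} => x y /= x0 y0; nra.
have bc : normc (z - 'i%C) <= normc (z + 'i%C).
  rewrite -(ler_pXn2r (n := 2)) ?nnegrE ?normc_ge0// !sqr_normc_def.
  case: z x0 y0 {zi z0 a0 zi0 b0 c1} => x y /= x0 y0; nra.
have cb : 2 <= normc (z + 'i%C) + normc (z - 'i%C).
  have := normc_triangle (z + 'i%C) (- (z - 'i%C)).
  have -> : z + 'i%C + - (z - 'i%C) = 2 * 'i%C by ring.
  by rewrite normc_opp normcM normc_nat normc_i mulr1.
have ab : 1 <= normc z + normc (z - 'i%C).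
  have := normc_triangle z (- (z - 'i%C)).
  have -> : z + - (z - 'i%C) = 'i%C by ring.
  by rewrite normc_opp normc_i.
have e0 := normc_ge0 (period_jump z).
have nb : normc (3 * z ^+ 2 - 1) <=
    2 * normc z * normc (z + 'i%C) + normc (z - 'i%C) ^+ 2.
  have -> : 3 * z ^+ 2 - 1 = 2 * z * (z + 'i%C) + (z - 'i%C) ^+ 2.
    by have := sqr_i K; move: 'i%C => i i2; rewrite -i2; ring.
  by rewrite (le_trans (normc_triangle _ _))// !(normcM, normcX) normc_nat.
have na : normc (3 * z ^+ 2 - 1) <= 3 * normc z ^+ 2 + 1.
  by rewrite (le_trans (normc_triangle _ _))// normcM normcX normc_nat normc_opp normc1.
have n0 := normc_ge0 (3 * z ^+ 2 - 1).
have abc : 1 - normc z ^+ 2 <= normc (z - 'i%C) * normc (z + 'i%C).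
  rewrite -normcM -sqr_add1_factor.
  have := normc_triangle (z ^+ 2 + 1) (- z ^+ 2).
  by rewrite addrAC subrr add0r normc1 normc_opp normcX; lra.
have [b25|b25] := leP (normc (z - 'i%C)) (2 / 5).
  right; have b2 := sqr_normc_def (z - 'i%C).
  have ej : normc (period_jump z) <= 2 * pi * normc (z - 'i%C) *
      ((1 - 9 / 8 * complex.Im (z - 'i%C) ^+ 2 + 9 / 8 * complex.Re (z - 'i%C) ^+ 2)
       / (1 - 3 * complex.Re (z - 'i%C))).
    have := normc_period_jump_near (y := complex.Im z) x0.
    have zE : complex.Re z +i* (complex.Im z - 1) = z - 'i%C.
      by apply/eqP; case: (z) => x y; rewrite eq_complex /= subr0 !eqxx.
    have jE : period_jump (complex.Re z +i* complex.Im z) = period_jump z.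
      by congr period_jump; case: (z).
    have reE : complex.Re (z - 'i%C) = complex.Re z by rewrite -zE.
    have imE : complex.Im (z - 'i%C) = complex.Im z - 1 by rewrite -zE.
    by rewrite zE jE reE imE; apply.
  have {}x0 : complex.Re (z - 'i%C) <= 0.
    by case: (z) x0 => x y /=; rewrite oppr0 addr0.
  rewrite /pdist ler0_norm// real_normK ?num_real//.
  apply: le_trans (near_resonance_arith x0 b0 b25 b2 e0 n0 ej nb _) _ => //.
    (* By [ab] and [cb], [|z| >= 3/5] and [|z + i| >= 8/5]; their product is the required
       [24/25]. *)
    by rewrite (@le_trans _ _ (3 / 5 * (8 / 5)))//; [lra|apply: ler_pM; lra].
  have /andP[_ a12] := parabolic_alpha_bound (K := K).
  have := ler_wpM2r (sqr_ge0 (complex.Im (z - 'i%C))) a12.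
  lra.
left; rewrite ler_pdivrMr; last first.
  by rewrite !mulr_gt0//; lra.
have [a25|a25] := leP (normc z) (2 / 5).
  apply: (le_trans (ler_pM e0 n0 (normc_period_jump_le x0) na)).
  move: (normc z) (normc (z - 'i%C) * normc (z + 'i%C)) a0 abc a25 => a d *.
  rewrite [leLHS](_ : _ = pi * a * (2 * (3 * a ^+ 2 + 1))); last by ring.
  rewrite [leRHS](_ : _ = pi * a * (99 / 25 * d)); last by field.
  apply: ler_wpM2l; first by rewrite mulr_ge0; lra.
  (* Since [d >= 1 - a^2], the worst case is [a = 2/5], where [74/25 <= 99/25 * 21/25]. *)
  nra.
apply: (le_trans (ler_pM e0 n0 (normc_period_jump_le2 x0) nb)).
move: (normc z) (normc (z - 'i%C)) (normc (z + 'i%C)) a0 b0 c1 bc cb ab b25 a25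
   {nb na n0 abc} => a b c *.
have abc0 : 0 <= a * (b * c) by rewrite !mulr_ge0; lra.
apply: (@le_trans _ _ (297 / 25 * (a * (b * c)))); last first.
  rewrite [leRHS](_ : _ = 99 / 25 * pi * (a * (b * c))); last by field.
  by apply: ler_wpM2r => //; lra.
(* The goal is now [2 (2 a c + b^2) <= 297/25 a b c]. For [b > 1] the left side is at most
   [9 a b c], by [b <= c] and [a >= 2/5]. *)
have [b1|b1] := leP b 1; last first.
  have : b * b <= b * c by apply: ler_wpM2l; lra.
  have : 2 / 5 * (b * c) <= a * (b * c) by rewrite ler_wpM2r// ?mulr_ge0; lra.
  have : a * c <= b * (a * c) by rewrite ler_peMl ?mulr_ge0; lra.
  lra.
(* For [b <= 1] the goal reads [b^2 <= a c (297/50 b - 2)], whose right side increases with [a c].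
   On each range of [b], inserting a lower bound for [a c] leaves an inequality that is concave in
   [b] and holds at both ends. *)
have [b35|b35] := leP b (3 / 5).
  have P : 14 / 25 <= a * c.
    by rewrite (@le_trans _ _ (2 / 5 * (7 / 5)))//; [lra|apply: ler_pM; lra].
  have : 0 <= (a * c - 14 / 25) * (297 / 50 * b - 2) by rewrite mulr_ge0; lra.
  nra.
have P : 2 / 5 <= a * c.
  by rewrite (@le_trans _ _ (2 / 5 * 1))//; [lra|apply: ler_pM; lra].
have : 0 <= (a * c - 2 / 5) * (297 / 50 * b - 2) by rewrite mulr_ge0; lra.
nra.
Qed.

Lemma conjc_i : ('i%C)^*%C = - 'i%C :> K[i].
Proof. by apply/eqP; rewrite eq_complex /= oppr0 !eqxx. Qed.

Lemma pdist_conj z w : pdist z^*%C w^*%C = pdist z w.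
Proof. by case: z w => x y [u v]; rewrite /pdist /= -opprD normrN. Qed.

Lemma normc_filter_symbol_conj z :
  normc (filter_symbol z^*%C) = normc (filter_symbol z).
Proof.
have [->|z0] := eqVneq z 0; first by rewrite rmorph0.
rewrite /filter_symbol conjc_eq0 (negbTE z0) !(normcM, normcV).
rewrite normc_period_jump_conj normc_conj.
have -> : 3 * z^*%C ^+ 2 - 1 = (3 * z ^+ 2 - 1)^*%C.
  by rewrite rmorphB rmorphM rmorphXn rmorph1 rmorph_nat.
have -> : z^*%C ^+ 2 + 1 = (z ^+ 2 + 1)^*%C.
  by rewrite rmorphD rmorphXn rmorph1.
by rewrite !normc_conj.
Qed.

Lemma filter_symbol_contraction z : complex.Re z <= 0 -> z != 'i%C -> z != - 'i%C ->
  normc (filter_symbol z) <=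
  Num.max (1 - Num.min (pdist z 'i%C) (pdist z (- 'i%C))) (1 - 1 / 100).
Proof.
move=> x0 zi zNi; rewrite oppr_min addr_maxr !le_max.
have [y0|y0] := leP 0 (complex.Im z).
  have [h|->//] := normc_filter_symbol_le x0 y0 zi.
  by apply/orP; right; lra.
have [|||h|] := @normc_filter_symbol_le z^*%C.
- by case: z x0 {zi zNi y0}.
- by case: z y0 {zi zNi x0} => a b /= ?; lra.
- by apply: contra_neq zNi => /(congr1 conjc); rewrite conjcK conjc_i.
- by rewrite normc_filter_symbol_conj in h; apply/orP; right; lra.
(* Conjugation turns the distance to [i] into the distance to [-i], the other argument of the
   minimum. *)
rewrite normc_filter_symbol_conj -{1}['i%C]conjcK conjc_i pdist_conj => ->.
by rewrite orbT.
Qed.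

End Contraction.

(** * Complex functions of a real variable *)

Section ComplexCalculus.
Context {K : realType}.
Implicit Types (f g : K -> K[i]) (t : K) (l : K[i]).

Lemma complexP (z w : K[i]) :
  complex.Re z = complex.Re w -> complex.Im z = complex.Im w -> z = w.
Proof. by case: z w => a b [c d] /= -> ->. Qed.

Lemma complex_ReD (z w : K[i]) : complex.Re (z + w) = complex.Re z + complex.Re w.
Proof. by case: z w => a b [c d]. Qed.

Lemma complex_ImD (z w : K[i]) : complex.Im (z + w) = complex.Im z + complex.Im w.
Proof. by case: z w => a b [c d]. Qed.

Lemma complex_ReM (z w : K[i]) : complex.Re (z * w) =
  complex.Re z * complex.Re w - complex.Im z * complex.Im w.
Proof. by case: z w => a b [c d]. Qed.

Lemma complex_ImM (z w : K[i]) : complex.Im (z * w) =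
  complex.Re z * complex.Im w + complex.Im z * complex.Re w.
Proof. by case: z w => a b [c d]. Qed.

(** Stated by parts so that it unfolds to the differential equation in [is_ivp_solution]; [cwithin]
    does the same for its continuity clause. *)
Definition is_cderive f t l : Prop :=
  is_derive t 1 (fun s => complex.Re (f s)) (complex.Re l) /\
  is_derive t 1 (fun s => complex.Im (f s)) (complex.Im l).

Lemma is_cderive_eq f t l l' : is_cderive f t l -> l = l' -> is_cderive f t l'.
Proof. by move=> fl <-. Qed.

Lemma is_cderive_ext f g t l : f =1 g -> is_cderive f t l -> is_cderive g t l.
Proof. by move=> /funext <-. Qed.

Lemma is_cderive_cst (c : K[i]) t : is_cderive (fun=> c) t 0.
Proof. by split; exact: is_derive_cst. Qed.

Lemma is_cderiveD f g t l l' : is_cderive f t l -> is_cderive g t l' ->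
  is_cderive (fun s => f s + g s) t (l + l').
Proof.
move=> [f1 f2] [g1 g2]; split.
  under eq_fun do rewrite complex_ReD; rewrite complex_ReD; exact: is_deriveD.
by under eq_fun do rewrite complex_ImD; rewrite complex_ImD; exact: is_deriveD.
Qed.

Lemma is_cderiveM f g t l l' : is_cderive f t l -> is_cderive g t l' ->
  is_cderive (fun s => f s * g s) t (l * g t + f t * l').
Proof.
move=> [f1 f2] [g1 g2]; split.
  under eq_fun do rewrite complex_ReM; apply: is_derive_eq.
  by rewrite complex_ReD !complex_ReM /GRing.scale/=; ring.
under eq_fun do rewrite complex_ImM; apply: is_derive_eq.
by rewrite complex_ImD !complex_ImM /GRing.scale/=; ring.
Qed.

Lemma is_cderiveMl (c : K[i]) f t l : is_cderive f t l ->
  is_cderive (fun s => c * f s) t (c * l).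
Proof.
move=> fl; apply: is_cderive_eq (is_cderiveM (is_cderive_cst c t) fl) _.
by rewrite mul0r add0r.
Qed.

Lemma is_cderiveMr (c : K[i]) f t l : is_cderive f t l ->
  is_cderive (fun s => f s * c) t (l * c).
Proof.
move=> fl; apply: is_cderive_eq (is_cderiveM fl (is_cderive_cst c t)) _.
by rewrite mulr0 addr0.
Qed.

Lemma is_cderive_sum n (f : 'I_n -> K -> K[i]) t (l : 'I_n -> K[i]) :
  (forall k, is_cderive (f k) t (l k)) ->
  is_cderive (fun s => \sum_(k < n) f k s) t (\sum_(k < n) l k).
Proof.
move=> fl; elim: n f l fl => [|n IH] f l fl.
  rewrite big_ord0; apply: is_cderive_ext (is_cderive_cst 0 t) => s.
  by rewrite big_ord0.
rewrite big_ord_recl.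
apply: (@is_cderive_ext (fun s => f ord0 s + \sum_(k < n) f (lift ord0 k) s)).
  by move=> s; rewrite big_ord_recl.
by apply: is_cderiveD => //; exact: IH.
Qed.

Lemma is_cderive_real (h : K -> K) t (dh : K) :
  is_derive t 1 h dh -> is_cderive (fun s => (h s)%:C) t dh%:C.
Proof. by move=> hh; split=> //=; exact: is_derive_cst. Qed.

Lemma cexp_scale t l : cexp (t%:C * l) =
  (expR (t * complex.Re l) * cos (t * complex.Im l)) +i*
  (expR (t * complex.Re l) * sin (t * complex.Im l)).
Proof.
by case: l => a b; apply: complexP; rewrite /cexp /expi /= !mul0r !subr0 !addr0.
Qed.

Lemma is_cderive_cexp l t :
  is_cderive (fun s => cexp (s%:C * l)) t (l * cexp (t%:C * l)).
Proof.
split; under eq_fun do rewrite cexp_scale /=.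
  rewrite cexp_scale complex_ReM /=; apply: is_derive_eq.
  by rewrite /GRing.scale/=; ring.
rewrite cexp_scale complex_ImM /=; apply: is_derive_eq.
by rewrite /GRing.scale/=; ring.
Qed.

Lemma cexp0 : cexp 0 = 1 :> K[i].
Proof. by apply: complexP; rewrite /cexp /expi /= cos0 sin0 expR0; ring. Qed.

Lemma cexpD (z w : K[i]) : cexp (z + w) = cexp z * cexp w.
Proof.
by apply: complexP; rewrite /cexp /expi ?(complex_ReM, complex_ImM) complex_ReD complex_ImD /= expRD ?cosD ?sinD; ring.
Qed.

Lemma cexp_iE (omega t : K) : cexp (t%:C * ('i%C * omega%:C)) = expi (omega * t).
Proof.
rewrite cexp_scale /expi /= !mul0r !mul1r subr0 add0r mulr0 expR0 !mul1r.
by rewrite mulrC.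
Qed.

Definition cwithin (D : set K) f : Prop :=
  {within D, continuous (fun t => complex.Re (f t))} /\
  {within D, continuous (fun t => complex.Im (f t))}.

Lemma cwithinD D f g : cwithin D f -> cwithin D g -> cwithin D (fun t => f t + g t).
Proof.
move=> [f1 f2] [g1 g2]; split => x.
  by under eq_fun do rewrite complex_ReD; exact: (cvgD (f1 x) (g1 x)).
by under eq_fun do rewrite complex_ImD; exact: (cvgD (f2 x) (g2 x)).
Qed.

Lemma cwithinM D f g : cwithin D f -> cwithin D g -> cwithin D (fun t => f t * g t).
Proof.
move=> [f1 f2] [g1 g2]; split => x.
  under eq_fun do rewrite complex_ReM.
  exact: (cvgB (cvgM (f1 x) (g1 x)) (cvgM (f2 x) (g2 x))).
under eq_fun do rewrite complex_ImM.
exact: (cvgD (cvgM (f1 x) (g2 x)) (cvgM (f2 x) (g1 x))).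
Qed.

Lemma is_cderive_within D f (df : K -> K[i]) :
  (forall t, is_cderive f t (df t)) -> cwithin D f.
Proof.
by move=> fdf; split; apply: continuous_subspaceT => t;
  apply/differentiable_continuous/derivable1_diffP; have [[? _] [? _]] := fdf t.
Qed.

Lemma cwithin_cst D (c : K[i]) : cwithin D (fun=> c).
Proof. by apply: is_cderive_within => t; exact: is_cderive_cst. Qed.

Lemma cwithin_sum D n (f : 'I_n -> K -> K[i]) :
  (forall k, cwithin D (f k)) -> cwithin D (fun s => \sum_(k < n) f k s).
Proof.
elim: n f => [|n IH] f fl.
  have -> : (fun s => \sum_(k < 0) f k s) = fun=> 0.
    by apply/funext => s; rewrite big_ord0.
  exact: cwithin_cst.
have -> : (fun s => \sum_(k < n.+1) f k s) =
    fun s => f ord0 s + \sum_(k < n) f (lift ord0 k) s.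
  by apply/funext => s; rewrite big_ord_recl.
by apply: cwithinD => //; exact: IH.
Qed.

Lemma cderive0_cst (a b : K) f : cwithin `[a, b] f ->
  (forall t, a < t < b -> is_cderive f t 0) ->
  forall t, a <= t <= b -> f t = f a.
Proof.
(* The mean value theorem holds for real-valued functions only, so it is applied to each part
   separately. *)
have real_cst (h : K -> K) : {within `[a, b], continuous h} ->
    (forall t, a < t < b -> is_derive t 1 h 0) -> forall t, a <= t <= b -> h t = h a.
  move=> hc h0 t /andP[a_t tb].
  have [||c _] := @MVT_segment _ h (fun=> 0) a t a_t.
  - move=> x; rewrite in_itv/= => /andP[ax xt]; apply: h0.
    by rewrite ax (lt_le_trans xt).
  - apply: continuous_subspaceW hc => x /=; rewrite !in_itv/= => /andP[-> xt].
    exact: le_trans tb.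
  - by rewrite mul0r => /eqP; rewrite subr_eq0 => /eqP.
move=> [fr fi] df t tab; apply: complexP.
  exact: (real_cst (fun t => complex.Re (f t)) fr (fun s hs => (df s hs).1) t tab).
exact: (real_cst (fun t => complex.Im (f t)) fi (fun s hs => (df s hs).2) t tab).
Qed.

(** The fundamental theorem of calculus on both parts; differentiability of [f] supplies the
    continuity of the integrand. *)
Lemma cintegral_cderive (a b : K) f F (df : K -> K[i]) : a < b ->
  (forall t, is_cderive F t (f t)) -> (forall t, is_cderive f t (df t)) ->
  cintegral a b f = F b - F a.
Proof.
move=> ab Ff fdf.
have FTC (h H dh : K -> K) : (forall t, is_derive t 1 H (h t)) ->
    (forall t, is_derive t 1 h (dh t)) ->
    \int[lebesgue_measure]_(t in `[a, b]) h t = H b - H a.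
  move=> Hh hdh.
  have cont (g dg : K -> K) : (forall t, is_derive t 1 g (dg t)) -> continuous g.
    move=> gdg t; apply/differentiable_continuous/derivable1_diffP.
    by case: (gdg t).
  rewrite /Rintegral (@continuous_FTC2 _ h H)//.
  - by apply: continuous_subspaceT; exact: cont hdh.
  - split; first by move=> x _; case: (Hh x).
      exact/cvg_at_right_filter/(cont _ _ Hh).
    exact/cvg_at_left_filter/(cont _ _ Hh).
  - by move=> x _; rewrite derive1E; case: (Hh x).
have re := FTC _ _ _ (fun t => (Ff t).1) (fun t => (fdf t).1).
have im := FTC _ _ _ (fun t => (Ff t).2) (fun t => (fdf t).2).
by rewrite /cintegral re im; case: (F b) (F a) => [? ?] [? ?].
Qed.

Lemma eq_cintegral (a b : K) f g : (forall t, a <= t <= b -> f t = g t) ->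
  cintegral a b f = cintegral a b g.
Proof.
by move=> fg; rewrite /cintegral; congr (_ +i* _);
  apply: eq_Rintegral => t; rewrite inE/= in_itv/= => /fg ->.
Qed.

End ComplexCalculus.

(** * Filtering exponentials over one period *)

Section TimeFilter.
Context {K : realType}.
Variable omega : K.
Hypothesis omega_gt0 : 0 < omega.
Implicit Types (t : K) (l : K[i]).

Definition time_filter t : K := cos (omega * t) - 4^-1.

Lemma is_cderive_time_filter t :
  is_cderive (fun s => (time_filter s)%:C) t (- omega * sin (omega * t))%:C.
Proof.
apply: is_cderive_real; rewrite /time_filter; apply: is_derive_eq.
by rewrite /GRing.scale/=; ring.
Qed.

Lemma period_gt0 : 0 < period omega.
Proof. by rewrite /period divr_gt0// mulr_gt0// pi_gt0. Qed.

Lemma omega_period : omega * period omega = 2 * pi.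
Proof. by rewrite /period; field; rewrite gt_eqF. Qed.

Lemma cos_omega_period : cos (omega * period omega) = 1.
Proof. by rewrite omega_period mulr_natl cos2pi. Qed.

Lemma sin_omega_period : sin (omega * period omega) = 0.
Proof. by rewrite omega_period mulr_natl sin2pi. Qed.

Lemma time_filter_antiderivative l :
  l != 'i%C * omega%:C -> l != - ('i%C * omega%:C) ->
  exists2 H : K -> K[i],
    forall t, is_cderive H t ((time_filter t)%:C * cexp (t%:C * l)) &
    (2 / period omega)%:C * (H (period omega) - H 0) = filter_symbol (l / omega%:C).
Proof.
move=> li lNi; have p0 := @pi_gt0 K.
have w0 : omega%:C != 0 :> K[i].
  by rewrite (fmorph_eq0 (real_complex K)) gt_eqF.
(* The general antiderivative divides by [l], so this case is integrated directly and matches the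
   value [-1/2] of [filter_symbol] at 0. *)
have [->|l0] := eqVneq l 0.
  exists (fun t => (sin (omega * t) / omega - t / 4)%:C).
    move=> t; rewrite mulr0 cexp0 mulr1; apply: is_cderive_real.
    apply: is_derive_eq; rewrite /time_filter /GRing.scale/=.
    by field; rewrite gt_eqF.
  rewrite (mul0r omega%:C^-1) /filter_symbol eqxx sin_omega_period mulr0 sin0 !mul0r !sub0r.
  rewrite -rmorphB -rmorphM -[2]/(2%:R) -(rmorph_nat (real_complex K)) -fmorphV -rmorphN.
  congr (_%:C); field; rewrite gt_eqF//; exact: period_gt0.
have lw : l ^+ 2 + omega%:C ^+ 2 != 0.
  have -> : l ^+ 2 + omega%:C ^+ 2 = (l - 'i%C * omega%:C) * (l + 'i%C * omega%:C).
    by rewrite -subr_sqr exprMn sqr_i mulN1r opprK.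
  by rewrite mulf_neq0 ?subr_eq0// -[X in l + X]opprK subr_eq0.
(* An antiderivative of [cos (omega t) exp (l t)] is [exp (l t) (l cos + omega sin) / (l^2 +
   omega^2)]. At both ends the cosine is 1 and the sine 0, so the increment carries the factor
   [l / (l^2 + omega^2) - 1 / (4 l)], the source of the numerator [3 z^2 - 1]. *)
exists (fun t => cexp (t%:C * l) *
  ((l ^+ 2 + omega%:C ^+ 2)^-1 * (l * (cos (omega * t))%:C
    + omega%:C * (sin (omega * t))%:C) - (4 * l)^-1)).
  move=> t.
  have dc : is_cderive (fun s => (cos (omega * s))%:C) t
      (- (omega%:C * (sin (omega * t))%:C)).
    rewrite -rmorphM -rmorphN; apply: is_cderive_real; apply: is_derive_eq.
    by rewrite /GRing.scale/=; ring.
  have ds : is_cderive (fun s => (sin (omega * s))%:C) t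
      (omega%:C * (cos (omega * t))%:C).
    rewrite -rmorphM; apply: is_cderive_real; apply: is_derive_eq.
    by rewrite /GRing.scale/=; ring.
  apply: is_cderive_eq (is_cderiveM (is_cderive_cexp l t) (is_cderiveD
    (is_cderiveMl _ (is_cderiveD (is_cderiveMl l dc) (is_cderiveMl omega%:C ds)))
    (is_cderive_cst _ t))) _.
  rewrite /time_filter rmorphB fmorphV rmorph_nat.
  by field; rewrite l0 lw.
rewrite cos_omega_period sin_omega_period !mulr0 cos0 sin0 mul0r cexp0.
rewrite /filter_symbol mulf_eq0 invr_eq0 (negbTE l0) (negbTE w0) /period_jump.
have -> : (2 * pi)%:C * (l / omega%:C) = (period omega)%:C * l.
  by rewrite -omega_period rmorphM; field.
have -> : (2 / period omega)%:C = omega%:C / pi%:C.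
  have -> : 2 / period omega = omega / pi.
    by rewrite /period; move: pi p0 => p p0; field; rewrite !gt_eqF.
  by rewrite rmorphM fmorphV.
have pi0 : pi%:C != 0 :> K[i] by rewrite (fmorph_eq0 (real_complex K)) gt_eqF.
rewrite rmorph0 rmorph1; move: (pi%:C) pi0 => p pi0.
by field; rewrite l0 w0 lw pi0.
Qed.

(** All terms of the antiderivative are periodic except [t / 2], whose increment is half a period.
    Hence the filter preserves the Helmholtz part of the solution. *)
Lemma time_filter_resonant_antiderivative : exists2 H : K -> K[i],
    forall t, is_cderive H t ((time_filter t)%:C * expi (omega * t)) &
    (2 / period omega)%:C * (H (period omega) - H 0) = 1.
Proof.
have w0 : omega != 0 by rewrite gt_eqF.
exists (fun t => (t / 2 + sin (omega * t) * cos (omega * t) / (2 * omega)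
                  - sin (omega * t) / (4 * omega)) +i*
                 (sin (omega * t) ^+ 2 / (2 * omega) + cos (omega * t) / (4 * omega))).
  move=> t; split; rewrite /time_filter ?(complex_ReM, complex_ImM) /=; apply: is_derive_eq;
    rewrite /GRing.scale/= ?mul0r ?subr0 ?addr0; have := cos2Dsin2 (omega * t).
    by move=> h; rewrite -[X in 2^-1 * X]h; field.
  by move=> _; field.
rewrite cos_omega_period sin_omega_period !mulr0 sin0 cos0.
have T0 : period omega != 0 by rewrite gt_eqF// period_gt0.
apply: complexP; rewrite ?(complex_ReM, complex_ImM) ?complex_ReD ?complex_ImD /=; field.
- by rewrite w0.
- by rewrite w0.
Qed.

End TimeFilter.

(** * The error propagation of the iteration *)

Section Propagation.
Context {K : realType} {m : nat}.
Variables (omega : K) (A R : 'M[K[i]]_m) (lambda : 'rV[K[i]]_m) (F : 'cV[K[i]]_m).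
Hypothesis omega_gt0 : 0 < omega.
Hypothesis R_unit : R \in unitmx.
Hypothesis A_diag : A = R *m diag_mx lambda *m invmx R.

(* In the eigenbasis, multiplying the difference of two solutions by
   [exp(- lambda_k t)] gives a constant. *)
Lemma ivp_unique (w0 : 'cV[K[i]]_m) (w1 w2 : K -> 'cV[K[i]]_m) :
  is_ivp_solution A F omega w0 w1 -> is_ivp_solution A F omega w0 w2 ->
  forall t, 0 <= t <= period omega -> w1 t = w2 t.
Proof.
move=> [w10 w1c w1d] [w20 w2c w2d] t tT.
suff : invmx R *m (w1 t - w2 t) = 0.
  move=> /(congr1 (mulmx R)); rewrite mulKVmx// mulmx0 => /eqP.
  by rewrite subr_eq0 => /eqP.
apply/matrixP => k j; rewrite (ord1 j) {j} [RHS]mxE.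
(* The difference is written with [-1 *] so that the sum and product rules apply directly. *)
pose d s := \sum_j (invmx R) k j * (w1 s j ord0 + -1 * w2 s j ord0).
have dE s : (invmx R *m (w1 s - w2 s)) k ord0 = d s.
  by rewrite mxE; apply: eq_bigr => j _; rewrite !mxE mulN1r.
pose g s := cexp (s%:C * - lambda ord0 k) * d s.
have gc : cwithin `[0, period omega] g.
  apply: cwithinM; first by apply: is_cderive_within => s; exact: is_cderive_cexp.
  apply: cwithin_sum => j; apply: cwithinM; first exact: cwithin_cst.
  apply: cwithinD; first exact: w1c.
  by apply: cwithinM; [exact: cwithin_cst|exact: w2c].
have gd s : 0 < s < period omega -> is_cderive g s 0.
  move=> sT; apply: is_cderive_eq (is_cderiveM (is_cderive_cexp _ s)
    (is_cderive_sum (fun j => is_cderiveMl (invmx R k j)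
      (is_cderiveD (w1d s j sT) (is_cderiveMl (-1) (w2d s j sT)))))) _.
  rewrite -/(d s); set dd := \sum_(_ < _) _; suff -> : dd = lambda ord0 k * d s by ring.
  have -> : dd = (invmx R *m (A *m (w1 s - w2 s))) k ord0.
    rewrite [RHS]mxE; apply: eq_bigr => j _; congr (_ * _).
    by rewrite mulmxBr /rhs !mxE; ring.
  rewrite A_diag -!mulmxA mulKmx// mul_diag_mx mxE; congr (_ * _); exact: dE.
have := cderive0_cst gc gd tT.
have -> : g 0 = 0 by rewrite /g -dE w10 w20 subrr mulmx0 mxE mulr0.
move=> /eqP; rewrite /g mulf_eq0 dE => /orP[/eqP e0|/eqP//].
have : cexp (t%:C * - lambda ord0 k) * cexp (t%:C * lambda ord0 k) = 1.
  by rewrite -cexpD mulrN addNr cexp0.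
by rewrite e0 mul0r => /eqP; rewrite eq_sym oner_eq0.
Qed.

Variable ws : 'cV[K[i]]_m.
Hypothesis ws_sol : helmholtz A F omega ws.

Definition explicit_solution (w0 : 'cV[K[i]]_m) (t : K) : 'cV[K[i]]_m :=
  expi (omega * t) *: ws
  + R *m (\col_k (cexp (t%:C * lambda ord0 k) * (invmx R *m (w0 - ws)) k ord0)).

Lemma explicit_solution_entry w0 t j : explicit_solution w0 t j ord0 =
  expi (omega * t) * ws j ord0 + \sum_k R j k *
    (cexp (t%:C * lambda ord0 k) * (invmx R *m (w0 - ws)) k ord0).
Proof. by rewrite !mxE; congr (_ + _); apply: eq_bigr => k _; rewrite !mxE. Qed.

Lemma is_cderive_explicit_solution w0 t j :
  is_cderive (fun s => explicit_solution w0 s j ord0) t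
    (rhs A F omega t (explicit_solution w0 t) j ord0).
Proof.
apply: is_cderive_ext (fun s => esym (explicit_solution_entry w0 s j)) _.
have de : is_cderive (fun s => expi (omega * s)) t
    ('i%C * omega%:C * expi (omega * t)).
  apply: (@is_cderive_ext _ (fun s => cexp (s%:C * ('i%C * omega%:C)))).
    by move=> s; rewrite cexp_iE.
  by rewrite -cexp_iE; exact: is_cderive_cexp.
apply: is_cderive_eq (is_cderiveD (is_cderiveMr _ de)
  (is_cderive_sum (fun k => is_cderiveMl (R j k)
    (is_cderiveMr _ (is_cderive_cexp (lambda ord0 k) t))))) _.
(* The Helmholtz equation eliminates [F], leaving [A] to act on the eigenmodes alone. *)
have FE : F = A *m ws - ('i%C * omega%:C) *: ws.
  by rewrite ws_sol opprB addrC subrK.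
have -> : rhs A F omega t (explicit_solution w0 t) =
    ('i%C * omega%:C * expi (omega * t)) *: ws + R *m (diag_mx lambda *m
      \col_k (cexp (t%:C * lambda ord0 k) * (invmx R *m (w0 - ws)) k ord0)).
  rewrite /rhs /explicit_solution FE; set v := \col_k _.
  have Av : A *m (R *m v) = R *m (diag_mx lambda *m v).
    by rewrite A_diag -!mulmxA mulKmx.
  rewrite mulmxDr Av -scalemxAr scalerBr opprB addrC addrA subrK.
  by rewrite scalerA [expi _ * _]mulrC.
rewrite mxE [(_ *: ws) _ _]mxE [(R *m _) _ _]mxE; congr (_ + _).
apply: eq_bigr => k _; rewrite mul_diag_mx [in RHS]mxE -mulrA.
by congr (_ * (_ * _)); rewrite ?(ord1 0)// [RHS]mxE.
Qed.

Lemma ivp_solutionE w0 t : 0 <= t <= period omega ->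
  ivp_solution A F omega w0 t = explicit_solution w0 t.
Proof.
have sol : is_ivp_solution A F omega w0 (explicit_solution w0).
  split.
  - rewrite /explicit_solution mulr0 /expi cos0 sin0.
    rewrite [X in X *: _](_ : _ = 1)// scale1r.
    have -> : \col_k (cexp (0%:C * lambda ord0 k) * (invmx R *m (w0 - ws)) k ord0)
        = invmx R *m (w0 - ws).
      by apply/matrixP => k j; rewrite (ord1 j) mxE rmorph0 mul0r cexp0 mul1r.
    by rewrite mulKVmx// addrC subrK.
  - move=> j; exact: (@is_cderive_within _ _ _
      (fun t => rhs A F omega t (explicit_solution w0 t) j ord0)
      (fun t => is_cderive_explicit_solution w0 t j)).
  - by move=> s j _; exact: is_cderive_explicit_solution.
(* Since the explicit solution exists, [xget] returns a genuine solution and not its default;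
   uniqueness identifies the two on the period. *)
exact: (ivp_unique (xgetPex _ (ex_intro _ _ sol)) sol).
Qed.

Hypothesis nonresonant : forall j,
  lambda ord0 j <> 'i%C * omega%:C /\ lambda ord0 j <> - ('i%C * omega%:C).

Lemma waveholtz_error w0 : waveholtz A F omega w0 - ws =
  R *m (\col_k (filter_symbol (lambda ord0 k / omega%:C)
                * (invmx R *m (w0 - ws)) k ord0)).
Proof.
have [H0 dH0 H0E] := time_filter_resonant_antiderivative omega_gt0.
have [H dH HE] : exists2 H : 'I_m -> K -> K[i],
    (forall k t, is_cderive (H k) t ((time_filter omega t)%:C
       * cexp (t%:C * lambda ord0 k))) &
    forall k, (2 / period omega)%:C * (H k (period omega) - H k 0)
      = filter_symbol (lambda ord0 k / omega%:C).
  have ex k : exists H : K -> K[i],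
      (forall t, is_cderive H t ((time_filter omega t)%:C
       * cexp (t%:C * lambda ord0 k))) /\
      (2 / period omega)%:C * (H (period omega) - H 0)
      = filter_symbol (lambda ord0 k / omega%:C).
    have [/eqP h1 /eqP h2] := nonresonant k.
    by have [H ? ?] := time_filter_antiderivative omega_gt0 h1 h2; exists H.
  have [H HP] := choice ex.
  by exists H => k; have [] := HP k.
apply/matrixP => j j0; rewrite (ord1 j0) {j0}.
pose c k := (invmx R *m (w0 - ws)) k ord0.
have -> : (waveholtz A F omega w0 - ws) j ord0 = (2 / period omega)%:C *
    cintegral 0 (period omega)
      (fun t => (time_filter omega t)%:C * explicit_solution w0 t j ord0) - ws j ord0.
  rewrite !mxE; congr (_ * _ - _); apply: eq_cintegral => t tT.
  by rewrite ivp_solutionE.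
rewrite (@cintegral_cderive _ _ _ _
  (fun t => H0 t * ws j ord0 + \sum_k R j k * (H k t * c k)) _
  (period_gt0 omega_gt0) _ (fun t => is_cderiveM (is_cderive_time_filter omega t)
                              (is_cderive_explicit_solution w0 t j))); last first.
  move=> t; apply: is_cderive_eq (is_cderiveD (is_cderiveMr _ (dH0 t))
    (is_cderive_sum (fun k => is_cderiveMl (R j k) (is_cderiveMr (c k) (dH k t))))) _.
  rewrite explicit_solution_entry mulrDr mulrA mulr_sumr; congr (_ + _).
  by apply: eq_bigr => k _; rewrite /c; ring.
(* The resonant part integrates to exactly [ws] and cancels against [- ws]. *)
rewrite [RHS]mxE opprD addrACA -mulrBl -sumrB mulrDr mulrA H0E mul1r addrAC subrr add0r.
rewrite mulr_sumr; apply: eq_bigr => k _; rewrite !mxE -HE /c mxE; ring.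
Qed.

End Propagation.

(** * Norms and the resonance distance *)

Section VectorNorms.
Context {K : realType} {m : nat}.
Variable p : \bar K.
Hypothesis p_ge1 : (1 <= p)%E.
Implicit Types (u v : 'cV[K[i]]_m.+1) (M : 'M[K[i]]_m.+1).
Import ComplexField.Normc.

Lemma pnorm_ge0 v : 0 <= pnorm p v.
Proof. by case: p => [q||] //=; [exact: powR_ge0 | exact: bigmax_ge_id]. Qed.

Lemma normc_le_pnorm v j : normc (v j ord0) <= pnorm p v.
Proof.
case: p p_ge1 => [q||] //=; last by move=> _; exact: le_bigmax.
rewrite lee_fin => q1; have q0 : 0 < q by exact: lt_le_trans q1.
rewrite -{1}[normc _]powRr1 ?normc_ge0// -(divff (x := q)) ?gt_eqF// powRrM.
apply: ge0_ler_powR; rewrite ?nnegrE ?invr_ge0 ?powR_ge0 ?(ltW q0)//.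
  by apply: sumr_ge0 => k _; exact: powR_ge0.
by rewrite (bigD1 j)//= lerDl sumr_ge0// => k _; exact: powR_ge0.
Qed.

(** Through this entrywise comparison the diagonal error matrix contracts every p-norm with one and
    the same rate. *)
Lemma pnorm_le_scale (r : K) u v : 0 <= r ->
  (forall j, normc (u j ord0) <= r * normc (v j ord0)) ->
  pnorm p u <= r * pnorm p v.
Proof.
move=> r0 uv; case: p p_ge1 => [q||] //=.
  rewrite lee_fin => q1; have q0 : 0 < q by exact: lt_le_trans q1.
  have S0 (w : 'cV[K[i]]_m.+1) : 0 <= \sum_(j < m.+1) normc (w j ord0) `^ q.
    by apply: sumr_ge0 => k _; exact: powR_ge0.
  rewrite -{1}[r]powRr1// -(divff (x := q)) ?gt_eqF// powRrM -powRM ?powR_ge0//.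
  apply: ge0_ler_powR; rewrite ?nnegrE ?invr_ge0 ?mulr_ge0 ?powR_ge0 ?(ltW q0)//.
  rewrite mulr_sumr; apply: ler_sum => j _; rewrite -powRM ?normc_ge0//.
  by apply: ge0_ler_powR; rewrite ?nnegrE ?mulr_ge0 ?normc_ge0 ?(ltW q0).
move=> _; apply: bigmax_le => [|j _].
  by rewrite mulr_ge0//; exact: bigmax_ge_id.
by apply: (le_trans (uv j)); apply: ler_wpM2l => //; exact: le_bigmax.
Qed.

Lemma pnorm0 : pnorm p (0 : 'cV[K[i]]_m.+1) = 0.
Proof.
apply/eqP; rewrite eq_le pnorm_ge0 andbT -[leRHS](mul0r (pnorm p (0 : 'cV_m.+1))).
by apply: pnorm_le_scale => // j; rewrite mxE normc0 mul0r.
Qed.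

Lemma pnorm_gt0 v : v != 0 -> 0 < pnorm p v.
Proof.
move=> v0; have [j vj0] : exists j, v j ord0 != 0.
  apply/existsP; apply: contraNT v0; rewrite negb_exists => /forallP v0.
  apply/eqP/matrixP => j k; rewrite (ord1 k) [RHS]mxE.
  by apply/eqP; rewrite -[_ == _]negbK v0.
exact: lt_le_trans (normc_gt0 vj0) (normc_le_pnorm v j).
Qed.

(** Any crude constant will do: the bound ensures that the [sup] defining [op_pnorm] is taken over a
    bounded set. *)
Lemma pnorm_mulmx_bounded M : exists C, forall v, pnorm p (M *m v) <= C * pnorm p v.
Proof.
pose S := \sum_i \sum_j normc (M i j).
have S0 i : 0 <= \sum_j normc (M i j) by apply: sumr_ge0 => j _; exact: normc_ge0.
have tri n (f : 'I_n -> K[i]) : normc (\sum_j f j) <= \sum_j normc (f j).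
  elim: n f => [|n IH] f; first by rewrite !big_ord0 normc0.
  rewrite !big_ord_recl; apply: le_trans (normc_triangle _ _) _.
  by rewrite lerD2l.
exists (S * pnorm p (const_mx 1 : 'cV[K[i]]_m.+1)) => v.
rewrite mulrAC; apply: pnorm_le_scale.
  by rewrite mulr_ge0 ?pnorm_ge0// sumr_ge0.
move=> i; rewrite [X in normc X <= _]mxE [const_mx _ _ _]mxE normc1 mulr1.
apply: (le_trans (tri _ _)); apply: (@le_trans _ _ ((\sum_j normc (M i j)) * pnorm p v)).
  rewrite mulr_suml; apply: ler_sum => j _; rewrite normcM.
  by apply: ler_wpM2l; [exact: normc_ge0|exact: normc_le_pnorm].
apply: ler_wpM2r; first exact: pnorm_ge0.
by rewrite /S [leRHS](bigD1 i)//= lerDl sumr_ge0.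
Qed.

Lemma pnorm_mulmx_le M v : pnorm p (M *m v) <= op_pnorm p M * pnorm p v.
Proof.
have [->|v0] := eqVneq v 0; first by rewrite mulmx0 pnorm0 mulr0.
rewrite -ler_pdivrMr ?pnorm_gt0//; apply: ub_le_sup; last by exists v.
have [C MC] := pnorm_mulmx_bounded M.
by exists C => _ [u u0 <-]; rewrite ler_pdivrMr ?pnorm_gt0.
Qed.

Lemma op_pnorm_ge0 M : 0 <= op_pnorm p M.
Proof.
have n0 : (const_mx 1 : 'cV[K[i]]_m.+1) != 0.
  by apply/eqP => /matrixP /(_ ord0 ord0) /eqP; rewrite !mxE oner_eq0.
rewrite -(pmulr_lge0 _ (pnorm_gt0 n0)).
exact: le_trans (pnorm_ge0 _) (pnorm_mulmx_le _ _).
Qed.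

End VectorNorms.

(** * Convergence from geometric decay of the entries *)

Section Convergence.
Context {K : realType} {m : nat}.
Import ComplexField.Normc.

Lemma geometric_cvg_vec (u : nat -> 'cV[K[i]]_m) (l : 'cV[K[i]]_m) (C r : K) :
  0 <= r < 1 -> (forall n j, normc (u n j ord0 - l j ord0) <= C * r ^+ n) ->
  cvg_vec u l.
Proof.
move=> /andP[r0 r1] ul; apply/cvg_ballP => e e0.
(* Ball radii are positive elements of [K[i]], hence real. *)
have eE : e = (complex.Re e)%:C by rewrite RRe_real// gtr0_real.
have Re0 : 0 < complex.Re e by rewrite eE ltcR in e0.
have := @cvg_geometric _ C r; rewrite ger0_norm// => /(_ r1).
move=> /cvgrPdist_lt /(_ _ Re0); apply: filterS => n; rewrite sub0r normrN => Cr.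
split=> // i j; rewrite (ord1 j) -ball_normE /ball_/= eE.
rewrite distrC -[X in X < _]/((normc _)%:C) ltcR; apply: le_lt_trans (ul n i) _.
exact: le_lt_trans (ler_norm _) Cr.
Qed.

End Convergence.

(** * Positivity and invariance of the resonance distance *)

Section ResonanceDistance.
Context {K : realType}.

Lemma pdist_pm_gt0 (omega : K) (l : K[i]) : 0 < omega ->
  l <> 'i%C * omega%:C -> l <> - ('i%C * omega%:C) -> 0 < pdist_pm omega l.
Proof.
move=> w0 li lNi; have /andP[a0 _] := parabolic_alpha_bound (K := K).
have wC : omega%:C != 0 :> K[i].
  by rewrite (fmorph_eq0 (real_complex K)) gt_eqF.
have pdist_gt0 (z w : K[i]) : z <> w -> 0 < pdist z w.
  move=> zw; rewrite lt_def /pdist.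
  have h : 0 <= parabolic_alpha K * `|complex.Im (z - w)| ^+ 2.
    by rewrite mulr_ge0 ?sqr_ge0// ltW.
  rewrite addr_ge0// andbT paddr_eq0//.
  rewrite mulf_eq0 (gt_eqF a0)/= sqrf_eq0 !normr_eq0; apply/negP => /andP[/eqP h1 /eqP h2].
  by apply/zw/eqP; rewrite -subr_eq0; apply/eqP; apply: complexP.
rewrite /pdist_pm lt_min !pdist_gt0//.
  by move=> h; apply: lNi; rewrite -[LHS](divfK wC) h mulNr.
by move=> h; apply: li; rewrite -[LHS](divfK wC) h.
Qed.

Variables (m : nat) (omega : K).
Implicit Types lambda : 'rV[K[i]]_m.+1.

Lemma resonance_dist_le lambda j :
  resonance_dist omega lambda <= pdist_pm omega (lambda ord0 j).
Proof. exact: (bigmin_le _ j (fun k => pdist_pm omega (lambda ord0 k))). Qed.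

Lemma resonance_dist_gt0 lambda : 0 < omega ->
  (forall j, lambda ord0 j <> 'i%C * omega%:C /\ lambda ord0 j <> - ('i%C * omega%:C)) ->
  0 < resonance_dist omega lambda.
Proof.
move=> w0 nr; have h j : 0 < pdist_pm omega (lambda ord0 j).
  by have [? ?] := nr j; exact: pdist_pm_gt0.
by apply/bigmin_gtP; split.
Qed.

(** Every entry of one list is a root of the common polynomial, hence an entry of the other. So the
    distance depends on the matrix and not on the enumeration of its eigenvalues. *)
Lemma resonance_dist_char_poly lambda lambda' :
  \prod_j ('X - (lambda ord0 j)%:P) = \prod_j ('X - (lambda' ord0 j)%:P) ->
  resonance_dist omega lambda = resonance_dist omega lambda'.
Proof.
have le (l l' : 'rV[K[i]]_m.+1) : \prod_j ('X - (l ord0 j)%:P) = \prod_j ('X - (l' ord0 j)%:P) ->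
    resonance_dist omega l <= resonance_dist omega l' :> K.
  move=> ll; have ex (j : 'I_m.+1) : exists k, l' ord0 j = l ord0 k.
    have : root (\prod_j ('X - (l ord0 j)%:P)) (l' ord0 j).
      rewrite ll (bigD1 j)//= rootM root_XsubC eqxx//.
    rewrite -(big_map (fun k => l ord0 k) xpredT (fun a => 'X - a%:P)) root_prod_XsubC.
    by move=> /mapP[k _ ->]; exists k.
  have h j : resonance_dist omega l <= pdist_pm omega (l' ord0 j).
    by have [k ->] := ex j; exact: resonance_dist_le.
  by rewrite [leRHS]/resonance_dist; apply: le_bigmin.
by move=> ll; apply/eqP; rewrite eq_le !le.
Qed.

End ResonanceDistance.

(** The matrix [A - i omega] is similar to [diag (lambda_j - i omega)], whose diagonal has no
    zero. *)
Lemma helmholtz_unique (K : realType) (m : nat) (omega : K) (A R : 'M[K[i]]_m)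
    (lambda : 'rV[K[i]]_m) (F : 'cV[K[i]]_m) :
  R \in unitmx -> A = R *m diag_mx lambda *m invmx R ->
  (forall j, lambda ord0 j <> 'i%C * omega%:C) ->
  exists wstar, unique (helmholtz A F omega) wstar.
Proof.
move=> Ru AE nr; pose d := \row_j (lambda ord0 j - 'i%C * omega%:C).
have AdE : A - ('i%C * omega%:C)%:M = R *m diag_mx d *m invmx R.
  have -> : diag_mx d = diag_mx lambda - ('i%C * omega%:C)%:M.
    by apply/matrixP => i j; rewrite !mxE mulrnBl.
  rewrite mulmxBr mulmxBl -AE; congr (_ - _).
  by rewrite -scalemx1 -scalemxAr mulmx1 -scalemxAl mulmxV.
have du : diag_mx d \in unitmx.
  rewrite unitmxE det_diag unitfE; apply/prodf_neq0 => j _; rewrite mxE subr_eq0.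
  exact/eqP.
have Au : A - ('i%C * omega%:C)%:M \in unitmx.
  by rewrite AdE !unitmx_mul unitmx_inv Ru du.
have hE w : helmholtz A F omega w <-> (A - ('i%C * omega%:C)%:M) *m w = F.
  rewrite /helmholtz mulmxBl mul_scalar_mx; split=> [->|<-].
    by rewrite opprB addrC subrK.
  by rewrite opprB addrC subrK.
exists (invmx (A - ('i%C * omega%:C)%:M) *m F); split.
  by apply/hE; rewrite mulKVmx.
by move=> w /hE <-; rewrite mulKmx.
Qed.

(** * The convergence theorem *)

Theorem theorem1 (K : realType) :
  exists2 delta : K, 0 < delta < 1 &
  forall (m : nat) (omega : K) (A : 'M[K[i]]_m.+1), 0 < omega ->
  exists r : K,
  forall (F : 'cV[K[i]]_m.+1) (lambda : 'rV[K[i]]_m.+1) (R : 'M[K[i]]_m.+1),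
    char_poly A = \prod_(j < m.+1) ('X - (lambda ord0 j)%:P) ->
    (forall j, complex.Re (lambda ord0 j) <= 0) ->
    (forall j, lambda ord0 j <> 'i%C * omega%:C /\ lambda ord0 j <> - ('i%C * omega%:C)) ->
    R \in unitmx ->
    A = R *m diag_mx lambda *m invmx R ->
  let eps := resonance_dist omega lambda in
  [/\ 0 < eps,
      0 < r < 1,
      r <= Num.max (1 - eps) (1 - delta)
    & exists2 wstar : 'cV[K[i]]_m.+1,
        unique (helmholtz A F omega) wstar &
        forall w0 : 'cV[K[i]]_m.+1,
        let w := waveholtz_iterate A F omega w0 in
        cvg_vec w wstar /\
        forall (p : \bar K), (1 <= p)%E -> forall n : nat,
             pnorm p (invmx R *m (w n.+1 - wstar))
               <= r * pnorm p (invmx R *m (w n - wstar))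
          /\ pnorm p (w n - wstar)
               <= cond_number p R * r ^+ n * pnorm p (w 0%N - wstar)].
Proof.
exists (1 / 100); first by apply/andP; split; lra.
move=> m omega A omega0.
(* The rate must be fixed from [A] and [omega] before [lambda] is given, so it is computed from some
   list [l0] of eigenvalues. Were there none, the hypotheses on [lambda] would be contradictory and
   any rate would do. *)
have [[l0 charA]|nochar] := pselect (exists l : 'rV[K[i]]_m.+1,
    char_poly A = \prod_(j < m.+1) ('X - (l ord0 j)%:P)); last first.
  by exists 0 => F lambda R charA; case: nochar; exists lambda.
exists (Num.max (1 - resonance_dist omega l0) (1 - 1 / 100)) => F lambda R.
move=> charA' Re0 nr Ru AE eps.
have -> : resonance_dist omega l0 = eps.
  by apply: resonance_dist_char_poly; rewrite -charA.
have eps0 : 0 < eps by exact: resonance_dist_gt0.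
set r := Num.max _ _.
have r01 : 0 < r < 1.
  by rewrite /r lt_max gt_max; apply/and3P; split; [apply/orP; right| |]; lra.
have /andP[r0 r1] := r01.
have [ws wsP] := helmholtz_unique F Ru AE (fun j => (nr j).1).
split=> //; exists ws => // w0 w.
have wC : omega%:C != 0 :> K[i].
  by rewrite (fmorph_eq0 (real_complex K)) gt_eqF.
have symbol_le k : ComplexField.Normc.normc (filter_symbol (lambda ord0 k / omega%:C)) <= r.
  have [li lNi] := nr k.
  apply: (le_trans (filter_symbol_contraction _ _ _)).
  - rewrite -fmorphV complex_ReM /= mulr0 subr0 mulr_le0_ge0// invr_ge0 ltW//.
  - by apply/eqP => h; apply: li; rewrite -[LHS](divfK wC) h.
  - by apply/eqP => h; apply: lNi; rewrite -[LHS](divfK wC) h mulNr.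
  have := resonance_dist_le omega lambda k.
  rewrite -/eps /pdist_pm /r ge_max !le_max => h.
  by rewrite lexx orbT andbT lerD2l lerN2 h.
have step n : invmx R *m (w n.+1 - ws) = \col_k
    (filter_symbol (lambda ord0 k / omega%:C) * (invmx R *m (w n - ws)) k ord0).
  rewrite /w /waveholtz_iterate iterS (waveholtz_error omega0 Ru AE wsP.1 nr).
  by rewrite mulKmx.
have contract p : (1 <= p)%E -> forall n,
    pnorm p (invmx R *m (w n.+1 - ws)) <= r * pnorm p (invmx R *m (w n - ws)).
  move=> p1 n; apply: (pnorm_le_scale p1 (ltW r0)) => k.
  rewrite step mxE ComplexField.Normc.normcM.
  by apply: ler_wpM2r; [exact: normc_ge0|exact: symbol_le].
have decay p : (1 <= p)%E -> forall n, pnorm p (w n - ws) <=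
    cond_number p R * r ^+ n * pnorm p (w 0%N - ws).
  move=> p1 n.
  have iter_le : pnorm p (invmx R *m (w n - ws)) <=
      r ^+ n * pnorm p (invmx R *m (w 0%N - ws)).
    elim: n => [|n IH]; first by rewrite expr0 mul1r.
    apply: (le_trans (contract p p1 n)); rewrite exprS -mulrA.
    by apply: ler_wpM2l => //; exact: ltW.
  (* Leaving the eigenbasis after [n] steps costs the norm of [R]; entering it at step 0 costs that
     of its inverse. *)
  rewrite -{1}(mulKVmx Ru (w n - ws)).
  apply: (le_trans (pnorm_mulmx_le p1 _ _)).
  rewrite /cond_number -!mulrA; apply: ler_wpM2l; first exact: op_pnorm_ge0.
  apply: (le_trans iter_le); rewrite mulrCA; apply: ler_wpM2l.
    by rewrite exprn_ge0// ltW.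
  exact: pnorm_mulmx_le.
split; last by move=> p p1 n; split; [exact: contract | exact: decay].
(* Decay in the maximum norm bounds each entry. *)
apply: (@geometric_cvg_vec _ _ _ _ (cond_number +oo%E R * pnorm +oo%E (w 0%N - ws)) r).
  by rewrite ltW.
move=> n j; have := decay +oo%E (leey _) n; rewrite mulrAC; apply: le_trans.
have := normc_le_pnorm (p := +oo%E) (leey _) (w n - ws) j.
by rewrite !mxE.
Qed.
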